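(* Let $q$ be an odd prime power and let $m \ge 2$ be an integer with $\gcd(q-1, m(m-1)) = 2$. Then: (i) every $d \in \mathbb{F}_q$ is the discriminant of the same number of monic polynomials of degree $m$ in $\mathbb{F}_q[x]$ (namely $q^{m-1}$ of them); (ii) the discriminants of monic irreducible polynomials of degree $m$ in $\mathbb{F}_q[x]$ are equally distributed among half the elements of $\mathbb{F}_q^\times$: there is a subset $A \subseteq \mathbb{F}_q^\times$ with $|A| = (q-1)/2$ such that every monic irreducible polynomial of degree $m$ has discriminant in $A$, and every element of $A$ is the discriminant of the same (positive) number of monic irreducible polynomials of degree $m$ in $\mathbb{F}_q[x]$.
   Context: For a nonconstant polynomial $f$ of degree $m \ge 2$ over a field $K$ with leading coefficient $a_m$, factored as $f = a_m\prod_{i=1}^m (x-\alpha_i)$ in a splitting field, $\operatorname{disc}(f) = a_m^{2m-2}\prod_{i<j}(\alpha_i-\alpha_j)^2$; for linear $f$, $\operatorname{disc}(f) = 1$. $\mathbb{F}_q$ denotes the finite field with $q$ elements. *)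

(* Defs.v *)
From HB Require Import structures.
From mathcomp Require Import all_boot all_order all_algebra all_field.
From mathcomp Require Import qpoly.
Set Implicit Arguments. Unset Strict Implicit. Unset Printing Implicit Defensive.
Import GRing.Theory.
Local Open Scope ring_scope.

(* An algebraic closure of the finite (hence countable) field F, with its
   embedding; every polynomial over F splits there, so it serves as a
   splitting field for the definition of the discriminant. *)
Definition aclos (F : finFieldType) : countClosedFieldType :=
  projT1 (countable_algebraic_closure F).
Definition to_aclos (F : finFieldType) : {rmorphism F -> aclos F} :=
  sval (projT2 (countable_algebraic_closure F)).

(* the roots (with multiplicity) of f in the closure:
   f = lead_coef f * \prod_(z <- roots) (X - z) *)
Definition aclos_roots (F : finFieldType) (f : {poly F}) : seq (aclos F) :=
  sval (closed_field_poly_normal (map_poly (to_aclos F) f)).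

Definition disc_aclos (F : finFieldType) (f : {poly F}) : aclos F :=
  let r := aclos_roots f in
  let m := (size f).-1 in
  to_aclos F (lead_coef f) ^+ (2 * m - 2) *
  \prod_(i < size r) \prod_(j < size r | (i < j)%N) (r`_i - r`_j) ^+ 2.

(* The discriminant: 1 for linear f; for deg f >= 2, the (unique) element of F
   mapping to disc_aclos f (it lies in F since it is symmetric in the roots).
   The value on constants is irrelevant (default 0). *)
Definition disc (F : finFieldType) (f : {poly F}) : F :=
  if size f == 2%N then 1
  else odflt 0 [pick d : F | to_aclos F d == disc_aclos f].

(* Main.v *)
(* Let q = #|F| be odd and let h = (q - 1) / 2.  Scaling the roots of a monic
   polynomial of degree m by t multiplies its discriminant by t ^ (m (m - 1)).
   As gcd (q - 1, m (m - 1)) = 2, these factors are exactly the nonzero squares,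
   so the discriminant is equidistributed on each of the classes a ^ h = 1 and
   a ^ h = -1, and likewise when restricted to irreducible polynomials.

   An irreducible polynomial has a single Frobenius orbit of roots, on which
   Frobenius is a cycle of length m; hence Frobenius multiplies the Vandermonde
   product of the roots by (-1) ^ (m - 1), and (disc P) ^ h = (-1) ^ (m - 1).
   This selects the class in (ii).

   For (i), mu f := (-1) ^ (deg f) chi (disc f), with chi the quadratic
   character, is multiplicative on coprime polynomials because
   disc (f g) = disc f * disc g * r ^ 2, where r is a resultant, and mu P = -1 for P
   irreducible.
     So mu is the Moebius function of F[X], and Moebius inversion over the
   divisors d of f, resp. over the d with d ^ 2 dividing f, shows that the sum
   of mu over the monic polynomials of degree m >= 2 is 0 and that
   q ^ m - q ^ (m - 1) of them have a nonzero discriminant. *)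
Require Import Defs.
From HB Require Import structures.
From mathcomp Require Import all_boot all_order all_algebra all_field.
From mathcomp Require Import qpoly ring.
Import GRing.Theory.
Local Open Scope ring_scope.
Set Implicit Arguments.
Unset Strict Implicit.
Unset Printing Implicit Defensive.

(** * Vandermonde products and resultants of sequences *)

Section Vandermonde.
Variable R : comNzRingType.
Implicit Types s t : seq R.

(** Recursion on the sequence, rather than a double product over indices, lets concatenation,
    rotation and scaling be treated by induction; [prod_sqr_nth_vander] makes the link with the
    indexed product. *)
Fixpoint vander s : R :=
  if s is x :: s' then \prod_(y <- s') (x - y) * vander s' else 1.

(** On the root sequences of two monic polynomials this is their resultant. *)
Definition cross s t : R := \prod_(x <- s) \prod_(y <- t) (x - y).

Lemma cross_cons x s t : cross (x :: s) t = \prod_(y <- t) (x - y) * cross s t.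
Proof. by rewrite /cross big_cons. Qed.

Lemma vander_cat s t : vander (s ++ t) = vander s * vander t * cross s t.
Proof.
elim: s => [|x s IHs] /=; first by rewrite /cross big_nil mul1r mulr1.
by rewrite IHs cross_cons big_cat /=; ring.
Qed.

Lemma cross_cat s t1 t2 : cross s (t1 ++ t2) = cross s t1 * cross s t2.
Proof. by rewrite /cross -big_split; apply: eq_bigr => x _; rewrite big_cat. Qed.

Lemma cross_sqrC s t : cross s t ^+ 2 = cross t s ^+ 2.
Proof.
rewrite /cross exchange_big -!prodrXl; apply: eq_bigr => x _.
by rewrite -!prodrXl; apply: eq_bigr => y _; rewrite -sqrrN opprB.
Qed.

(** Moving [x] behind [s] flips exactly the [size s] factors that involve [x]. This is the sign of
    the cycle by which Frobenius acts on the roots of an irreducible polynomial. *)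
Lemma vander_rcons s x :
  vander (rcons s x) = (-1) ^+ size s * vander (x :: s).
Proof.
rewrite -cats1 vander_cat /= big_nil !mulr1 [in RHS]mulrA [RHS]mulrC.
congr (_ * _); rewrite /cross; elim: s => [|y s IHs];
  first by rewrite !big_nil mulr1.
by rewrite !big_cons IHs big_nil mulr1 exprS mulrACA mulN1r opprB.
Qed.

Lemma vander_sqr_perm s t :
  perm_eq s t -> vander s ^+ 2 = vander t ^+ 2.
Proof.
(* Exchanging adjacent blocks generates all permutations, and only the cross product of the two
   blocks changes, by a sign. *)
move=> st; apply: (catCA_perm_ind (P := fun u =>
  vander s ^+ 2 = vander u ^+ 2)) st _ => // s1 s2 s3 ->.
rewrite !vander_cat !cross_cat !exprMn [cross s1 s2 ^+ 2]cross_sqrC.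
by ring.
Qed.

Lemma prod_sqr_nth_vander s :
  \prod_(i < size s) \prod_(j < size s | (i < j)%N) (s`_i - s`_j) ^+ 2
    = vander s ^+ 2.
Proof.
elim: s => [|x s IHs] /=; first by rewrite big_ord0 expr1n.
rewrite big_ord_recl exprMn -IHs; congr (_ * _).
  by rewrite big_mkcond big_ord_recl /= mul1r -prodrXl (big_nth 0) big_mkord;
    apply: eq_bigr.
apply: eq_bigr => i _.
by rewrite big_mkcond big_ord_recl /= mul1r [RHS]big_mkcond; apply: eq_bigr.
Qed.

Lemma vander_scale a s :
  vander [seq a * z | z <- s] ^+ 2 = a ^+ (size s * (size s - 1)) * vander s ^+ 2.
Proof.
have: vander [seq a * z | z <- s] = a ^+ 'C(size s, 2) * vander s.
  elim: s => [|x s IHs] /=; first by rewrite mul1r.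
  have -> : \prod_(y <- [seq a * z | z <- s]) (a * x - y)
      = a ^+ size s * \prod_(y <- s) (x - y).
    rewrite big_map; elim: (s) => [|y t IHt]; first by rewrite !big_nil mul1r.
    by rewrite !big_cons IHt exprS; ring.
  by rewrite IHs binS bin1 exprD; ring.
by move=> ->; rewrite exprMn -exprM mulnC -mul_bin_diag bin1 subn1.
Qed.

End Vandermonde.

Lemma vander_map (R S : comNzRingType) (f : {rmorphism R -> S}) s :
  vander (map f s) = f (vander s).
Proof.
elim: s => [|x s IHs] /=; first by rewrite rmorph1.
rewrite IHs rmorphM rmorph_prod big_map; congr (_ * _).
by apply: eq_bigr => y _; rewrite rmorphB.
Qed.

Lemma cross_map (R S : comNzRingType) (f : {rmorphism R -> S}) s t :
  cross (map f s) (map f t) = f (cross s t).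
Proof.
rewrite /cross rmorph_prod big_map; apply: eq_bigr => x _.
by rewrite rmorph_prod big_map; apply: eq_bigr => y _; rewrite rmorphB.
Qed.

Lemma vander_eq0 (R : idomainType) (s : seq R) : (vander s == 0) = ~~ uniq s.
Proof.
elim: s => [|x s IHs] /=; first by rewrite oner_eq0.
rewrite mulf_eq0 IHs negb_and negbK; congr (_ || _).
by rewrite prodf_seq_eq0 -has_pred1; apply: eq_has => y /=; rewrite subr_eq0 eq_sym.
Qed.

Lemma cross_eq0 (R : idomainType) (s t : seq R) : (cross s t == 0) = has (mem s) t.
Proof.
rewrite has_sym prodf_seq_eq0; apply: eq_has => x /=.
by rewrite prodf_seq_eq0 -has_pred1; apply: eq_has => y /=; rewrite subr_eq0 eq_sym.
Qed.

(** * The Frobenius map of the closure and descent to the base field *)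

Lemma card_finField_pnat (F : finFieldType) (K : nzRingType) (f : {rmorphism F ->
  K}) :
  [pchar K].-nat #|F|.
Proof.
have [p p_pr charFp] := finPcharP F.
have := pprimeChar_pgroup charFp; rewrite /pgroup.pgroup cardsT.
by apply: sub_in_pnat => r _ /eqnP ->; exact: rmorph_pchar f _ charFp.
Qed.

Section Frobenius.
Variable F : finFieldType.
Local Notation iota := (to_aclos F).
Local Notation "p ^%F" := (map_poly iota p) (at level 2, format "p ^%F").
Implicit Types (f g h : {poly F}) (x : aclos F).

Definition frob x : aclos F := x ^+ #|F|.

Fact frob_is_additive : nmod_morphism frob.
Proof.
split; first by rewrite /frob expr0n; case: #|F| (finNzRing_gt1 F).
by move=> x y; apply: exprDn_pchar (card_finField_pnat iota).
Qed.

Fact frob_is_multiplicative : monoid_morphism frob.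
Proof. by split; [apply: expr1n | apply: exprMn]. Qed.

HB.instance Definition _ := GRing.isNmodMorphism.Build _ _ frob frob_is_additive.
HB.instance Definition _ := GRing.isMonoidMorphism.Build _ _ frob
  frob_is_multiplicative.

Lemma frob_iota a : frob (iota a) = iota a.
Proof. by rewrite /frob -rmorphXn expf_card. Qed.

(** The fixed points are the roots of ['X^#|F| - 'X], which already splits over [F], with the
    elements of [F] as its roots. *)
Lemma frob_fixed x : frob x = x -> exists a, x = iota a.
Proof.
move=> xP; have: root (map_poly iota ('X^#|F| - 'X)) x.
  by rewrite rmorphB /= map_polyXn map_polyX rootE !hornerE -/(frob x) xP subrr.
rewrite finField_genPoly map_prod_XsubC -(big_map iota predT (fun z =>
  'X - z%:P)) root_prod_XsubC.
by case/mapP => a _ ->; exists a.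
Qed.

Lemma poly_frob_fixed (p : {poly aclos F}) :
  map_poly frob p = p -> exists f, p = f^%F.
Proof.
move=> pP; have coefP i : exists a, p`_i == iota a.
  have [|a ->] := @frob_fixed p`_i; last by exists a.
  by rewrite -[in RHS]pP coef_map.
exists (\poly_(i < size p) xchoose (coefP i)); apply/polyP => i.
rewrite coef_map coef_poly; case: ltnP => [_|/leq_sizeP/(_ i (leqnn _)) ->].
  exact/eqP/(xchooseP (coefP i)).
by rewrite raddf0.
Qed.

Lemma aclos_rootsE f : f \is monic -> f^%F = \prod_(z <- aclos_roots f) ('X - z%:P).
Proof.
move=> f_monic; rewrite /aclos_roots; case: closed_field_poly_normal => s /= {1}->.
by rewrite lead_coef_map (monicP f_monic) rmorph1 scale1r.
Qed.

Lemma perm_map_frob f s :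
  f^%F = \prod_(z <- s) ('X - z%:P) -> perm_eq (map frob s) s.
Proof.
move=> fE; apply: prod_XsubC_eq; rewrite big_map -map_prod_XsubC -fE.
by rewrite -map_poly_comp; apply: eq_map_poly => a /=; rewrite frob_iota.
Qed.

(** All later work on [disc] goes through this formula. The squared Vandermonde product is symmetric
    and Frobenius permutes the roots, so it is fixed and comes from [F]; hence the default of [disc]
    is never reached on monic polynomials. *)
Lemma discE f s : f \is monic -> f^%F = \prod_(z <- s) ('X - z%:P) ->
  iota (disc f) = vander s ^+ 2.
Proof.
move=> f_monic fE.
have szf : size f = (size s).+1 by rewrite -(size_map_poly iota) fE size_prod_XsubC.
rewrite /disc szf; case: eqP => [[]|_].
  (* For linear [f] the Vandermonde product is empty, in agreement with the convention. *)
  by case: s {fE szf} => [|x []] //= _; rewrite big_nil mulr1 expr1n rmorph1.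
have ->: disc_aclos f = vander s ^+ 2.
  rewrite /disc_aclos (monicP f_monic) rmorph1 expr1n mul1r prod_sqr_nth_vander.
  by apply/vander_sqr_perm/prod_XsubC_eq; rewrite -fE aclos_rootsE.
case: pickP => [d /eqP //|noD].
have [|a aE] := @frob_fixed (vander s ^+ 2); last by have := noD a; rewrite aE eqxx.
rewrite rmorphXn -(vander_map frob s).
exact/vander_sqr_perm/(perm_map_frob fE).
Qed.
End Frobenius.

(** * Frobenius orbits of roots of irreducible polynomials *)

Lemma looping_injective (T : eqType) (f : T -> T) x n :
  injective f -> looping f x n -> exists2 k, (0 < k <= n)%N & iter k f x = x.
Proof.
move=> f_inj /trajectP[i i_n E]; exists (n - i)%N;
  first by rewrite subn_gt0 i_n leq_subr.
have inj_i : injective (iter i f) by elim: (i) => //= j IH y z /f_inj/IH.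
by apply: inj_i; rewrite -iterD subnKC // ltnW.
Qed.

Lemma map_traject (T : Type) (f : T -> T) x n :
  map f (traject f x n) = traject f (f x) n.
Proof. by elim: n x => //= n IHn x; rewrite IHn. Qed.

Section Orbit.
Variable F : finFieldType.
Local Notation iota := (to_aclos F).
Local Notation "p ^%F" := (map_poly iota p) (at level 2, format "p ^%F").
Local Notation frob := (@frob F).
Implicit Types (f g h P : {poly F}) (x : aclos F).

Lemma frob_inj : injective frob.
Proof. exact: fmorph_inj. Qed.

Lemma minpoly_exists x :
  exists P, [/\ P \is monic, irreducible_poly P & root P^%F x].
Proof.
(* Lying in [F] is decided by testing invariance under Frobenius. *)
have dec : decidable_embedding iota.
  move=> y; case: (frob y =P y) => [/frob_fixed|yP]; first by left.
  by right => -[a ya]; case: yP; rewrite ya frob_iota.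
have int_x : integralOver iota x := svalP (projT2 (countable_algebraic_closure
  F)) x.
by have [P [? ? ?]] := minPoly_decidable_closure dec int_x; exists P.
Qed.

Lemma root_irreducible P h x : irreducible_poly P -> root P^%F x ->
  root h^%F x = (P %| h).
Proof.
move=> P_irr Px; apply/idP/idP => [hx|/dvdpP[u ->]]; last first.
  by rewrite rmorphM rootM Px orbT.
rewrite -[_ %| _]negbK -irreducible_poly_coprime // -(coprimep_map iota).
by apply/negP => /coprimep_root/(_ Px); rewrite -rootE hx.
Qed.

Lemma root_frob h x : root h^%F (frob x) = root h^%F x.
Proof.
rewrite -[RHS](fmorph_root frob) -map_poly_comp.
by congr (root _ _); apply: eq_map_poly => a /=; rewrite frob_iota.
Qed.

(** Let [k.+1] be the least period of [x]. The product of the ['X - z%:P] over its orbit is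
    Frobenius invariant, so it comes from some [G] over [F]. [G] divides [P] because the orbit
    consists of distinct roots of [P], and [P] divides [G] because [x] is a root of [G]; both are
    monic. *)
Lemma irreducible_orbit P x (n := (size P).-1) :
    P \is monic -> irreducible_poly P -> root P^%F x ->
  [/\ uniq (traject frob x n), iter n frob x = x
    & P^%F = \prod_(z <- traject frob x n) ('X - z%:P)].
Proof.
move=> P_monic P_irr Px.
have roots_traj h k : root h^%F x -> all (root h^%F) (traject frob x k).
  move=> hx; apply/allP => _ /trajectP[i _ ->].
  by elim: i => //= i; rewrite root_frob.
have exk : exists k, (0 < k)%N && (iter k frob x == x).
  (* Otherwise [P] would have more roots than its degree. *)
  have : ~~ uniq (traject frob x n.+1).
    apply: contraL (Px) => traj_uniq; apply/negP => _.
    have := max_poly_roots _ (roots_traj P n.+1 Px) traj_uniq.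
    rewrite size_traject map_poly_eq0 monic_neq0 // size_map_poly => /(_ isT).
    by rewrite /n prednK ?ltnn // size_poly_gt0 monic_neq0.
  rewrite looping_uniq negbK =>
    /(looping_injective frob_inj)[k /andP[k0 _] /eqP kx].
  by exists k; rewrite k0.
have [[//|k] /andP[_ /eqP kx] k_min] := ex_minnP exk.
have traj_uniq : uniq (traject frob x k.+1).
  rewrite looping_uniq; apply/negP =>
    /(looping_injective frob_inj)[j /andP[j0 jk] jx].
  by have := k_min j; rewrite j0 jx eqxx ltnNge jk => /(_ isT).
have [|G GE] := @poly_frob_fixed F (\prod_(z <- traject frob x k.+1) ('X - z%:P)).
  rewrite map_prod_XsubC -(big_map frob predT (fun z => 'X - z%:P)).
  apply/perm_big; rewrite map_traject trajectSr -iterSr kx.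
  by rewrite perm_rcons.
have Gx : root G^%F x by rewrite -GE root_prod_XsubC mem_head.
have PG : P^%F = G^%F.
  apply/eqP; rewrite -eqp_monic ?map_monic //; last first.
    by rewrite -(map_monic iota) -GE monic_prod_XsubC.
  rewrite /eqp -{2}GE dvdp_map -(root_irreducible _ P_irr Px) Gx /=.
  have := uniq_roots_dvdp (roots_traj P k.+1 Px); rewrite uniq_rootsE; exact.
have -> : n = k.+1 by rewrite /n -(size_map_poly iota) PG -GE size_prod_XsubC
  size_traject.
by rewrite PG.
Qed.
End Orbit.

(** * The discriminant, the quadratic character and the Moebius function *)

Lemma natr_card_eq0 (F : finFieldType) : #|F|%:R = 0 :> F.
Proof.
have q_gt1 := finNzRing_gt1 F.
have /pnatP := card_finField_pnat (@idfun F : {rmorphism F -> F}).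
move=> /(_ (ltnW q_gt1) _ (pdiv_prime q_gt1) (pdiv_dvd _)) p_char.
by apply/eqP; rewrite -(dvdn_pcharf p_char) pdiv_dvd.
Qed.

Lemma odd_card_neqN1 (F : finFieldType) : odd #|F| -> (-1 != 1 :> F).
Proof.
move=> q_odd; rewrite eq_sym -subr_eq0 opprK; apply/eqP => two0.
have := natr_card_eq0 F;
  rewrite -(odd_double_half #|F|) q_odd -mul2n natrD natrM [2%:R]two0 mul0r addr0.
by move/eqP; rewrite oner_eq0.
Qed.

Section Discriminant.
Variable F : finFieldType.
Local Notation iota := (to_aclos F).
Local Notation "p ^%F" := (map_poly iota p) (at level 2, format "p ^%F").
Local Notation frob := (@frob F).
Implicit Types (f g h P : {poly F}) (x : aclos F).

Lemma disc1 : disc (1 : {poly F}) = 1.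
Proof.
apply: (fmorph_inj iota); rewrite (@discE _ _ [::]) ?monic1 //;
  first by rewrite expr1n rmorph1.
by rewrite big_nil rmorph1.
Qed.

(** Here [r] is the resultant: Frobenius permutes both root sequences, so it lies in [F], and it
    vanishes only at a common root. *)
Lemma discM f g : f \is monic -> g \is monic -> coprimep f g ->
  exists2 r, r != 0 & disc (f * g) = disc f * disc g * r ^+ 2.
Proof.
move=> f_monic g_monic fg.
set s := aclos_roots f; set t := aclos_roots g.
have fE : f^%F = \prod_(z <- s) ('X - z%:P) by apply: aclos_rootsE.
have gE : g^%F = \prod_(z <- t) ('X - z%:P) by apply: aclos_rootsE.
have [|r rE] := @frob_fixed F (cross s t).
  rewrite -(cross_map frob) /cross (perm_big _ (perm_map_frob fE)) /=.
  by apply: eq_bigr => x _; exact/perm_big/(perm_map_frob gE).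
exists r.
  rewrite -(fmorph_eq0 iota) -rE cross_eq0; apply/negP => /hasP[z zt zs].
  move: fg; rewrite -(coprimep_map iota) => fg.
  have fz : root f^%F z by rewrite fE root_prod_XsubC.
  by have := coprimep_root fg fz; rewrite -rootE gE root_prod_XsubC zt.
apply: (fmorph_inj iota);
  rewrite rmorphM rmorphXn rmorphM /= (discE f_monic fE) (discE g_monic gE).
rewrite (@discE _ (f * g) (s ++ t)) ?monicMl ?big_cat ?rmorphM /= ?fE ?gE //.
by rewrite vander_cat rE !exprMn.
Qed.

Lemma disc_eq0 f : f \is monic -> (disc f == 0) = ~~ separable_poly f.
Proof.
move=> f_monic; have fE := aclos_rootsE f_monic.
rewrite -(fmorph_eq0 iota) (discE f_monic fE) sqrf_eq0 vander_eq0.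
by rewrite -separable_prod_XsubC -fE separable_map.
Qed.

Lemma irreducible_dvdp_exists f : (1 < size f)%N ->
  exists P, [/\ P \is monic, irreducible_poly P & P %| f].
Proof.
move=> f_gt1;
  have /closed_rootP[x fx] : size f^%F != 1%N by rewrite size_map_poly neq_ltn
  f_gt1 orbT.
have [P [P_monic P_irr Px]] := minpoly_exists x.
by exists P; rewrite -(root_irreducible _ P_irr Px).
Qed.

Lemma separable_irreducible P : P \is monic -> irreducible_poly P ->
  separable_poly P.
Proof.
move=> P_monic P_irr.
have /closed_rootP[x Px] : size P^%F != 1%N by rewrite size_map_poly neq_ltn
  P_irr.1 orbT.
have [traj_uniq _ PE] := irreducible_orbit P_monic P_irr Px.
by rewrite -(separable_map iota) PE separable_prod_XsubC.
Qed.

(** Induction on the degree: write [f = g * P] with [P] irreducible, hence separable. If [f] is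
    inseparable, then either [g] already is, or [P] divides [g]. *)
Lemma disc_eq0P f : f \is monic -> disc f = 0 ->
  exists P, [/\ P \is monic, irreducible_poly P & P ^+ 2 %| f].
Proof.
move=> f_monic /eqP; rewrite disc_eq0 //.
have [n] := ubnP (size f); elim: n f f_monic => // n IHn f f_monic f_n f_insep.
have f_gt1 : (1 < size f)%N.
  rewrite ltnNge; apply: contra f_insep => /size1_polyC fE.
  have := monicP f_monic; rewrite fE lead_coefC => ->.
  by rewrite unlock derivC coprimep0 eqpxx.
have [P [P_monic P_irr /dvdpP[g fE]]] := irreducible_dvdp_exists f_gt1.
have g_monic : g \is monic by rewrite -(monicMr _ P_monic) -fE.
move: f_insep;
  rewrite fE separable_mul (separable_irreducible P_monic P_irr) /= negb_and.
case/orP => [g_insep|]; last first.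
  rewrite coprimep_sym irreducible_poly_coprime // negbK => Pg.
  by exists P; split=> //; rewrite expr2 dvdp_mul2r ?irredp_neq0.
have [|Q [Q_monic Q_irr Qg]] := IHn g g_monic _ g_insep.
  move: f_n; rewrite fE size_monicM ?monic_neq0 // ltnS; apply: leq_trans.
  by case: (size P) P_irr.1 => [|[|k]] // _; rewrite !addnS ltnS leq_addr.
by exists Q; split=> //; apply: dvdp_mulr.
Qed.

Lemma disc_sqr_dvd f P : f \is monic -> (1 < size P)%N -> P ^+ 2 %| f -> disc f = 0.
Proof.
move=> f_monic P_gt1 Pf; apply/eqP; rewrite disc_eq0 //.
apply/negP => /separable_polyP[/(_ P P)]; rewrite -expr2 => /(_ Pf).
by rewrite coprimepp gtn_eqF.
Qed.

Lemma disc_irreducible P : odd #|F| -> P \is monic -> irreducible_poly P ->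
  disc P != 0 /\ disc P ^+ #|F|./2 = (-1) ^+ size P.
Proof.
move=> q_odd P_monic P_irr.
have [x Px] : exists x, root P^%F x.
  by apply/closed_rootP; rewrite size_map_poly neq_ltn P_irr.1 orbT.
have [traj_uniq nx PE] := irreducible_orbit P_monic P_irr Px.
have dE := discE P_monic PE; set s := traject _ _ _ in traj_uniq PE dE.
have V0 : vander s != 0 by rewrite vander_eq0 negbK.
split; first by rewrite -(fmorph_eq0 iota) dE sqrf_eq0.
apply: (fmorph_inj iota); rewrite rmorphXn dE -exprM mul2n rmorph_sign.
(* One more factor [vander s] turns the exponent [2 * #|F|./2] into [#|F|], so the left side becomes
   the Frobenius image of [vander s], that is, the product over the rotated orbit. *)
apply: (mulIf V0);
  rewrite -exprSr -add1n -[1%N]/(true : nat) -q_odd odd_double_half.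
rewrite -/(frob _) -(vander_map frob) /s map_traject.
case: (size P) P_irr.1 nx => [|[|n]] // _; rewrite [_.-1]/= => nx.
rewrite trajectSr -iterSr nx vander_rcons size_traject -trajectS.
by rewrite !exprS mulN1r mulNr mul1r opprK.
Qed.

(** The quadratic character, by Euler's criterion. Its values are taken in [int], so that sums over
    polynomials are genuine counts. *)
Definition chi (a : F) : int :=
  if a == 0 then 0 else if a ^+ #|F|./2 == 1 then 1 else -1.

Lemma half_card_sign (a : F) : odd #|F| -> a != 0 -> 
  (a ^+ #|F|./2 == 1) || (a ^+ #|F|./2 == -1).
Proof.
move=> q_odd a0; rewrite -eqf_sqr expr1n -exprM muln2; apply/eqP/(mulIf a0).
rewrite -exprSr mul1r -add1n -[1%N]/(true : nat) -q_odd odd_double_half.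
exact: expf_card.
Qed.

Lemma chiM a b : odd #|F| -> chi (a * b) = chi a * chi b.
Proof.
move=> q_odd; rewrite /chi mulf_eq0; have [-> | a0] /= := eqVneq a 0;
  first by rewrite mul0r.
have [_ | b0] /= := eqVneq b 0; first by rewrite mulr0.
rewrite exprMn; have := half_card_sign q_odd a0; have := half_card_sign q_odd b0.
by case/orP=> /eqP->; case/orP=> /eqP->;
  rewrite ?mulrNN ?mulr1 ?mul1r !(eqxx, negPf (odd_card_neqN1 q_odd)).
Qed.

Lemma chi_sqr a : odd #|F| -> a != 0 -> chi (a ^+ 2) = 1.
Proof.
by move=> q_odd a0; rewrite expr2 chiM // /chi (negPf a0); case: ifP.
Qed.

(** Pellet's formula for the Moebius function on monic polynomials over a field of odd order. *)
Definition mu f : int := (-1) ^+ (size f).-1 * chi (disc f).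

Lemma mu1 : mu 1 = 1.
Proof. by rewrite /mu size_poly1 disc1 mul1r /chi oner_eq0 expr1n eqxx. Qed.

Lemma mu_irreducible P : odd #|F| -> P \is monic -> irreducible_poly P -> mu P = -1.
Proof.
move=> q_odd P_monic P_irr; have [d0 dE] := disc_irreducible q_odd P_monic P_irr.
rewrite /mu /chi (negPf d0) dE; case: (size P) P_irr.1 => //= n _.
rewrite exprS -[(-1 : F) ^+ n]signr_odd -[(-1 : int) ^+ n]signr_odd.
case: odd; rewrite ?expr1 ?expr0 ?mulrNN ?mulr1 ?eqxx ?mulr1 //.
by rewrite (negPf (odd_card_neqN1 q_odd)) mul1r.
Qed.

Lemma muM f g : odd #|F| -> f \is monic -> g \is monic -> coprimep f g ->
  mu (f * g) = mu f * mu g.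
Proof.
move=> q_odd f_monic g_monic fg; have [r r0 dE] := discM f_monic g_monic fg.
rewrite /mu dE chiM // chi_sqr // mulr1 chiM // [RHS]mulrACA; congr (_ * _).
rewrite -exprD size_monicM ?monic_neq0 //; congr (_ ^+ _).
by move: (monic_neq0 f_monic) (monic_neq0 g_monic); rewrite -!size_poly_gt0;
  case: size => // ?; case: size => // ? _ _; rewrite addSn addnS.
Qed.

End Discriminant.

(** * Enumeration of monic polynomials and Moebius sums *)

Section Monics.
Variable F : finFieldType.
Implicit Types (f g d P : {poly F}).

Definition monics n : seq {poly F} := [seq 'X^n + val r | r : {poly_n F}].

Lemma mem_monics n f : (f \in monics n) = (f \is monic) && (size f == n.+1).
Proof.
apply/imageP/andP => [[r _ ->]|[f_monic /eqP szf]].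
  have rX : (size (val r) < size ('X^n : {poly F}))%N by rewrite size_polyXn ltnS
    size_npoly.
  by rewrite monicE lead_coefDl // lead_coefXn eqxx size_polyDl // size_polyXn.
have szr : (size (f - 'X^n)%R <= n)%N.
  apply/leq_sizeP => i; rewrite leq_eqVlt coefB coefXn => /orP[/eqP<-|n_i].
    by rewrite eqxx -[n]/(n.+1.-1) -szf -lead_coefE (monicP f_monic) subrr.
  by rewrite gtn_eqF // subr0 nth_default ?szf.
by exists (NPoly szr); rewrite //= addrC subrK.
Qed.

Lemma monics_uniq n : uniq (monics n).
Proof. by rewrite map_inj_uniq ?enum_uniq // => r s /addrI/val_inj. Qed.

Lemma size_monics n : size (monics n) = (#|F| ^ n)%N.
Proof. by rewrite size_map -cardE card_npoly. Qed.

(** A finite range that contains every monic divisor of a polynomial of degree [n]. *)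
Fixpoint monics_le n : seq {poly F} :=
  if n is n'.+1 then monics_le n' ++ monics n else monics 0.

Lemma mem_monics_le n f :
  (f \in monics_le n) = (f \is monic) && (size f <= n.+1)%N.
Proof.
elim: n => [|n IHn] /=; last first.
  rewrite mem_cat IHn mem_monics -andb_orr; congr (_ && _).
  by rewrite [in RHS]leq_eqVlt orbC.
rewrite mem_monics; have [f_monic|] //= := boolP (f \is monic).
by rewrite eqn_leq size_poly_gt0 monic_neq0 ?andbT.
Qed.

Lemma monics_le_uniq n : uniq (monics_le n).
Proof.
elim: n => [|n IHn] /=; first exact: monics_uniq.
rewrite cat_uniq IHn monics_uniq andbT /=; apply/hasPn => f.
by rewrite mem_monics mem_monics_le => /andP[_ /eqP->]; rewrite ltnn andbF.
Qed.

Lemma sum_monics_le n (G : {poly F} -> int) :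
  \sum_(f <- monics_le n) G f = \sum_(k < n.+1) \sum_(f <- monics k) G f.
Proof.
elim: n => [|n IHn]; first by rewrite big_ord1.
by rewrite big_cat IHn [RHS]big_ord_recr.
Qed.

(** Multiplication by [g] is a bijection from the monic polynomials of degree [n - j] onto its monic
    multiples of degree [n]. *)
Lemma count_monics_dvdp n g j : g \is monic -> size g = j.+1 ->
  count (dvdp g) (monics n) = if (j <= n)%N then (#|F| ^ (n - j))%N else 0%N.
Proof.
move=> g_monic szg; have g0 := monic_neq0 g_monic.
case: leqP => [j_n|n_j]; last first.
  apply/eqP; rewrite -leqn0 leqNgt -has_count; apply/hasPn => f.
  rewrite mem_monics => /andP[f_monic /eqP szf]; apply/negP.
  by move/dvdp_leq; rewrite monic_neq0 // szf szg ltnS leqNgt n_j => /(_ isT).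
rewrite -size_filter -size_monics -[RHS](size_map (fun h => h * g)).
apply/perm_size/uniq_perm; first by rewrite filter_uniq ?monics_uniq.
  by rewrite map_inj_uniq ?monics_uniq //; apply: mulIf.
move=> f; rewrite mem_filter mem_monics.
apply/andP/mapP => [[/dvdpP[h ->]]|[h]].
  rewrite monicMr // => /andP[h_monic]; rewrite size_Mmonic ?monic_neq0 //
    szg addnS /=.
  move=> /eqP szh; exists h => //; rewrite mem_monics h_monic /=.
  by apply/eqP; have := congr1 (subn^~ j) szh; rewrite addnK subSn.
rewrite mem_monics => /andP[h_monic /eqP szh] ->.
by rewrite dvdp_mull // monicMr // h_monic size_Mmonic ?monic_neq0 //
  szg szh addnS addSn subnK /=.
Qed.

Hypothesis q_odd : odd #|F|.

(* The involution exchanging [d] (prime to [P]) with [P * d] reverses the sign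
   of [mu], and [mu d = 0] for the remaining [d], divisible by [P ^+ 2]. *)
Lemma sum_mu_dvdp e f P n : (0 < e)%N -> f \is monic -> (size f <= n.+1)%N ->
    P \is monic -> irreducible_poly P -> P ^+ e %| f ->
  \sum_(d <- monics_le n | d ^+ e %| f) mu d = 0.
Proof.
move=> e0 f_monic szf P_monic P_irr Pf; have P0 := monic_neq0 P_monic.
have dvd_exp d : d %| d ^+ e by case: (e) e0 => // k _; rewrite exprS dvdp_mulr.
rewrite (bigID (fun d => P %| d)) /= (bigID (fun d => P ^+ 2 %| d)) /=.
rewrite big1_seq => [|d /andP[/andP[_ P2d]]]; last first.
  rewrite mem_monics_le => /andP[d_monic _].
  by rewrite /mu (disc_sqr_dvd d_monic P_irr.1 P2d) /chi eqxx mulr0.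
rewrite add0r -big_filter -[X in _ + X]big_filter.
set S1 := filter _ _; set S2 := filter _ _.
have S12 : perm_eq S1 [seq d * P | d <- S2].
  apply: uniq_perm; first by rewrite filter_uniq ?monics_le_uniq.
    by rewrite map_inj_uniq ?filter_uniq ?monics_le_uniq //; apply: mulIf.
  move=> d; rewrite mem_filter mem_monics_le.
  apply/andP/mapP => [[/andP[/andP[df /dvdpP[u dE]] P2d] /andP[d_monic szd]]|[u]].
    rewrite {}dE in d_monic szd df P2d *; exists u => //.
    rewrite mem_filter mem_monics_le -(monicMr _ P_monic) d_monic /=.
    rewrite (dvdp_trans _ df) ?dvdp_exp2r ?dvdp_mulr //=.
    rewrite expr2 dvdp_mul2r // in P2d; rewrite P2d /=.
    by apply: leq_trans szd; apply: dvdp_leq (monic_neq0 d_monic) (dvdp_mulr _ _).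
  rewrite mem_filter mem_monics_le => /andP[/andP[uf Pu] /andP[u_monic szu]] ->.
  (* [u] is prime to [P], so the two powers divide [f] jointly; this divisibility also keeps [u * P]
     within the degree bound. *)
  have uPf : (u * P) ^+ e %| f.
    rewrite exprMn Gauss_dvdp ?uf // coprimep_expl // coprimep_expr //.
    by rewrite coprimep_sym irreducible_poly_coprime.
  rewrite uPf dvdp_mull // expr2 dvdp_mul2r // Pu monicMr // u_monic; split=> //=.
  by apply: leq_trans szf;
    apply: dvdp_leq (monic_neq0 f_monic) (dvdp_trans (dvd_exp _) uPf).
rewrite (perm_big _ S12) big_map -big_split big1_seq //= => d.
rewrite mem_filter mem_monics_le => /andP[/andP[_ Pd] /andP[d_monic _]].
rewrite muM ?(mu_irreducible q_odd P_monic P_irr) ?mulrN1 ?addNr //.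
by rewrite coprimep_sym irreducible_poly_coprime.
Qed.

Definition sum_mu n := \sum_(d <- monics n) mu d.

(** Exchange the sums, then count the multiples of [d ^+ e] of degree [n]: they depend only on the
    degree [k] of [d]. *)
Lemma sum_sum_mu_dvdp e n :
  \sum_(f <- monics n) \sum_(d <- monics_le n | d ^+ e %| f) mu d
    = \sum_(k < n.+1) (if (k * e <= n)%N then (sum_mu k) * (#|F| ^ (n - k *
      e))%N%:R else 0).
Proof.
under eq_bigr do rewrite big_mkcond.
rewrite exchange_big sum_monics_le; apply: eq_bigr => k _ /=.
transitivity (\sum_(d <- monics k) mu d * (count (dvdp (d ^+ e)) (monics n))%:R).
  apply: eq_bigr => d _; rewrite -big_mkcond /= -sum1_count natr_sum mulr_sumr.
  by apply: eq_bigr => f _; rewrite mulr1.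
transitivity (\sum_(d <- monics k) mu d * (if (k * e <= n)%N then (#|F| ^ (n - k
  * e))%N else 0%N)%:R).
  rewrite big_seq [RHS]big_seq; apply: eq_bigr => d.
  rewrite mem_monics => /andP[d_monic /eqP szd].
  rewrite (@count_monics_dvdp _ _ (k * e)) ?monic_exp // .
  by have := size_exp d e; rewrite szd /= => <-; rewrite prednK //
    size_poly_gt0 expf_neq0 ?monic_neq0.
by rewrite -mulr_suml; case: ifP; rewrite // mulr0.
Qed.

Lemma sum_mu0 : sum_mu 0 = 1.
Proof.
rewrite /sum_mu (perm_big [:: 1]) ?big_seq1 ?mu1 //=.
apply: uniq_perm; rewrite ?monics_uniq // => f; rewrite mem_monics inE.
apply/idP/eqP => [/andP[/monicP f1 /eqP szf]|->]; last by rewrite monic1 size_poly1.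
rewrite (@size1_polyC _ f) ?szf //.
by move: f1; rewrite lead_coefE szf => ->.
Qed.

(** The case [e = 1]: a polynomial of positive degree has an irreducible factor, so each inner sum
    vanishes. In generating series, the sums of [mu] are the coefficients of the inverse of the zeta
    function, [1 - q T]. *)
Lemma sum_mu_conv n : (0 < n)%N ->
  \sum_(k < n.+1) sum_mu k * (#|F| ^ (n - k))%N%:R = 0.
Proof.
move=> n0; transitivity (\sum_(f <- monics n) \sum_(d <- monics_le n | d ^+ 1 %|
  f) mu d).
  rewrite sum_sum_mu_dvdp; apply: eq_bigr => k _.
  by rewrite muln1 -ltnS ltn_ord.
rewrite big1_seq //= => f; rewrite mem_monics => /andP[f_monic /eqP szf].
have [|P [P_monic P_irr Pf]] := @irreducible_dvdp_exists _ f;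
  first by rewrite szf ltnS.
by apply: (@sum_mu_dvdp 1 f P) => //; rewrite szf.
Qed.

Lemma sum_mu1 : sum_mu 1 = - #|F|%:R.
Proof.
have := sum_mu_conv (isT : 0 < 1)%N; rewrite big_ord_recl big_ord1 /=.
by rewrite sum_mu0 mul1r mulr1 expn1 => /eqP; rewrite addrC addr_eq0 => /eqP.
Qed.

Lemma sum_mu_eq0 n : (1 < n)%N -> sum_mu n = 0.
Proof.
case: n => [|[|n]] // _; have := sum_mu_conv (ltn0Sn n.+1).
rewrite big_ord_recr /= subnn mulr1 => <-.
rewrite [X in X + _](_ : _ = 0) ?add0r //.
(* All terms but the last form [#|F|] times the same relation one degree lower. *)
transitivity ((\sum_(k < n.+2) sum_mu k * (#|F| ^ (n.+1 - k))%N%:R) * #|F|%:R);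
  last first.
  by rewrite sum_mu_conv ?mul0r.
rewrite mulr_suml; apply: eq_bigr => k _.
by rewrite subSn -1?ltnS // expnSr natrM mulrA.
Qed.

(** The case [e = 2]: the inner sum is 1 if [f] is squarefree, where only [d = 1] contributes, and 0
    otherwise. As [sum_mu] vanishes from 2 on, only the terms [k = 0] and [k = 1] remain. *)
Lemma sum_disc_neq0 n : (1 < n)%N ->
  \sum_(f <- monics n) (disc f != 0)%:R = (#|F| ^ n)%N%:R - (#|F| ^ n.-1)%N%:R :>
    int.
Proof.
move=> n1.
transitivity (\sum_(f <- monics n) \sum_(d <- monics_le n | d ^+ 2 %| f) mu d).
  rewrite big_seq [RHS]big_seq; apply: eq_bigr => f.
  rewrite mem_monics => /andP[f_monic /eqP szf].
  have [df0|df0] := eqVneq (disc f) 0.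
    have [P [P_monic P_irr Pf]] := disc_eq0P f_monic df0.
    by rewrite (@sum_mu_dvdp 2 f P) ?szf.
  rewrite -big_filter (perm_big [:: 1]) ?big_seq1 ?mu1 //=.
  apply: uniq_perm; rewrite ?filter_uniq ?monics_le_uniq // => d.
  rewrite mem_filter mem_monics_le inE; apply/idP/eqP => [/and3P[df d_monic _]|->].
    have [d1|d1] := ltnP 1 (size d);
      first by rewrite (disc_sqr_dvd f_monic d1 df) eqxx in df0.
    by move: d_monic; rewrite (size1_polyC d1) monicE lead_coefC => /eqP->.
  by rewrite expr1n dvd1p monic1 size_poly1.
rewrite sum_sum_mu_dvdp; case: n n1 => [|[|n]] // _.
rewrite 2!big_ord_recl /= big1 => [|k _]; last by rewrite /bump /= sum_mu_eq0 //
  mul0r if_same.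
by rewrite sum_mu0 sum_mu1 mul0n mul1n subn0 mul1r addr0 subn2 /= mulNr -natrM
  -expnS.
Qed.

End Monics.

(** * Scaling the roots of a polynomial *)

Lemma comp_scaleX_K (F : fieldType) (t : F) : t != 0 ->
  cancel (comp_poly (t *: 'X)) (comp_poly (t^-1 *: 'X)).
Proof.
move=> t0 f; rewrite -comp_polyA comp_polyZ comp_polyX scalerA mulfV // scale1r.
exact: comp_polyXr.
Qed.

Lemma size_comp_scaleX (F : fieldType) (t : F) f : t != 0 ->
  size (f \Po (t *: 'X)) = size f.
Proof. by move=> t0; rewrite size_comp_poly2 // size_scale ?size_polyX. Qed.

Lemma irreducible_poly_comp_scaleX (F : fieldType) (t : F) f : t != 0 ->
  irreducible_poly f -> irreducible_poly (f \Po (t *: 'X)).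
Proof.
move=> t0 [f_gt1 f_irr]; split; first by rewrite size_comp_scaleX.
move=> g szg gf; have t0' : t^-1 != 0 by rewrite invr_eq0.
have := dvdp_comp_poly (t^-1 *: 'X) gf; rewrite comp_scaleX_K // => /f_irr.
rewrite size_comp_scaleX // => /(_ szg)/eqp_size; rewrite size_comp_scaleX // =>
  szgf.
by rewrite -dvdp_size_eqp // szgf size_comp_scaleX.
Qed.

Section Scaling.
Variable F : finFieldType.
Local Notation iota := (to_aclos F).
Local Notation "p ^%F" := (map_poly iota p) (at level 2, format "p ^%F").
Implicit Types (f g : {poly F}) (t : F).

(** The power of [t] makes the result monic again when [f] is. *)
Definition scale_roots t f := t ^+ (size f).-1 *: (f \Po (t^-1 *: 'X)).

Lemma map_scale_roots t f s : t != 0 -> f^%F = \prod_(z <- s) ('X - z%:P) ->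
  (scale_roots t f)^%F = \prod_(z <- [seq iota t * z | z <- s]) ('X - z%:P).
Proof.
move=> t0 fE;
  have szf : (size f).-1 = size s by rewrite -(size_map_poly iota) fE
  size_prod_XsubC.
rewrite /scale_roots szf map_polyZ map_comp_poly map_polyZ map_polyX fE big_map /=.
rewrite fmorphV rmorphXn; have : iota t != 0 by rewrite fmorph_eq0.
elim: s {fE szf} => [|z s IHs] c0; first by rewrite !big_nil rmorph1 scale1r.
rewrite !big_cons -IHs // rmorphM [size _]/= -scalerAr exprSr -scalerA scalerAl.
congr (_ *: (_ * _)); rewrite /= comp_polyB comp_polyX comp_polyC scalerBr scalerA.
by rewrite mulfV // scale1r -mul_polyC -polyCM.
Qed.

Lemma size_scale_roots t f : t != 0 -> size (scale_roots t f) = size f.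
Proof.
move=> t0; rewrite size_scale ?expf_neq0 // size_comp_scaleX //.
by rewrite invr_eq0.
Qed.

Lemma scale_roots_monic t f : t != 0 -> f \is monic -> scale_roots t f \is monic.
Proof.
move=> t0 /aclos_rootsE/(map_scale_roots t0) E.
by rewrite -(map_monic iota) E monic_prod_XsubC.
Qed.

Lemma disc_scale_roots t f (n := (size f).-1) : t != 0 -> f \is monic ->
  disc (scale_roots t f) = t ^+ (n * (n - 1)) * disc f.
Proof.
move=> t0 f_monic; have fE := aclos_rootsE f_monic.
apply: (fmorph_inj iota);
  rewrite (discE (scale_roots_monic t0 f_monic) (map_scale_roots t0 fE)).
rewrite rmorphM rmorphXn (discE f_monic fE) vander_scale.
by congr (_ ^+ (_ * (_ - 1)) * _);
  rewrite /n -(size_map_poly iota) fE size_prod_XsubC.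
Qed.

Lemma irreducible_scale_roots t f : t != 0 -> irreducible_poly f ->
  irreducible_poly (scale_roots t f).
Proof.
move=> t0 f_irr; have t0' : t^-1 != 0 by rewrite invr_eq0.
have [g_gt1 g_irr] := irreducible_poly_comp_scaleX t0' f_irr.
rewrite /scale_roots; set c := t ^+ _; have c0 : c != 0 by rewrite expf_neq0.
split=> [|h szh]; first by rewrite size_scale.
by rewrite dvdpZr // => /(g_irr _ szh) /eqp_trans -> //; rewrite eqp_sym eqp_scale.
Qed.

Lemma scale_roots_inj t n : t != 0 -> {in monics F n &, injective (scale_roots t)}.
Proof.
move=> t0 f g; rewrite !mem_monics => /andP[_ /eqP szf] /andP[_ /eqP szg].
rewrite /scale_roots szf szg /= => /scalerI; rewrite expf_neq0 // => /(_ isT).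
have t0' : t^-1 != 0 by rewrite invr_eq0.
exact: (can_inj (comp_scaleX_K t0')).
Qed.

(** [scale_roots t] injects the first family into the second. An inequality is enough, since the two
    values can later be exchanged. *)
Lemma leq_count_scale_roots (C : pred {poly F}) m t a : t != 0 ->
    {in monics F m, forall f, C f -> C (scale_roots t f)} ->
  (count (fun f => C f && (disc f == a)) (monics F m) <=
     count (fun f => C f && (disc f == t ^+ (m * (m - 1)) * a)%R) (monics F m))%N.
Proof.
move=> t0 C_scale; rewrite -!size_filter -(size_map (scale_roots t)).
apply: uniq_leq_size.
  rewrite map_inj_in_uniq ?filter_uniq ?monics_uniq // => f g.
  by rewrite !mem_filter => /andP[_ fm] /andP[_ gm]; apply: scale_roots_inj fm gm.
move=> _ /mapP[f + ->]; rewrite !mem_filter => /andP[/andP[Cf /eqP da] fm].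
rewrite C_scale //=; move: fm; rewrite !mem_monics => /andP[f_monic /eqP szf].
by rewrite disc_scale_roots // szf da eqxx scale_roots_monic //
  size_scale_roots // szf /=.
Qed.

End Scaling.

(** * Irreducible polynomials of every positive degree *)

(** Take the minimal polynomial of a primitive root of unity [x] of order [q ^ m - 1]. Its degree is
    the Frobenius period of [x], which is [m]. *)
Lemma monic_irreducible_exists (F : finFieldType) m : (0 < m)%N ->
  exists P : {poly F}, [/\ P \is monic, size P = m.+1 & irreducible_poly P].
Proof.
move=> m0; pose q := #|F|; have q_gt1 : (1 < q)%N := finNzRing_gt1 F.
have qm_gt1 : (1 < q ^ m)%N by rewrite -(exp1n m) ltn_exp2r.
pose n := (q ^ m).-1; have n0 : (0 < n)%N by rewrite /n -ltnS prednK // ltnW.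
have nE : (q ^ m = n.+1)%N by rewrite prednK // ltnW.
(* In the closure [n] equals -1, so ['X^n - 1] is separable and has [n] distinct roots. *)
have nK0 : n%:R != 0 :> aclos F.
  have: (q ^ m)%N%:R = 0 :> aclos F.
    rewrite natrX -(rmorph_nat (to_aclos F)) natr_card_eq0 rmorph0 expr0n.
    by case: (m) m0.
  rewrite nE -natr1 => /eqP; rewrite addr_eq0 => /eqP ->.
  by rewrite oppr_eq0 oner_eq0.
have [rs rsE] := closed_field_poly_normal ('X^n - 1 : {poly aclos F}).
rewrite lead_coefXnsubC // scale1r in rsE.
have rs_uniq : uniq rs by rewrite -separable_prod_XsubC -rsE separable_Xn_sub_1.
have rs_roots : all n.-unity_root rs.
  by apply/allP => z zrs; rewrite /root_of_unity rsE root_prod_XsubC.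
have rs_size : size rs = n.
  by have := size_prod_XsubC rs id; rewrite -rsE size_XnsubC // => -[].
have /hasP[x _ x_prim] := cyclic.has_prim_root n0 rs_roots rs_uniq (eq_leq (esym
  rs_size)).
have [P [P_monic P_irr Px]] := minpoly_exists x.
exists P; split=> //.
have iterE k : iter k (@frob F) x = x ^+ (q ^ k).
  by elim: k => //= k ->; rewrite /frob -exprM -expnSr.
have x0 : x != 0 by rewrite (prim_root_eq0 x_prim) -lt0n.
have [traj_uniq kx _] := irreducible_orbit P_monic P_irr Px.
have P_gt1 := P_irr.1;
  have [k szP] : exists k, size P = k.+2 by case: (size P) P_gt1 => [|[|k]] // _;
  exists k.
rewrite szP ?[_.-1]/= in traj_uniq kx *; congr _.+1; apply/eqP; rewrite eqn_leq;
  apply/andP; split.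
  (* If [m] were below the orbit length, [x] would occur at positions 0 and [m] of a duplicate-free
     orbit. *)
  rewrite leqNgt; apply/negP => m_k.
  have := nth_uniq x (i := 0) (j := m) _ _ traj_uniq.
  rewrite size_traject !nth_traject //
    [iter m _ _]iterE nE exprSr prim_expr_order //.
  by rewrite mul1r eqxx eq_sym -[m == _]negbK -lt0n m0 => /(_ isT m_k).
(* Conversely, since [x] has period [k.+1], its order [q ^ m - 1] divides [q ^ k.+1 - 1]. *)
have qk_gt0 : (0 < q ^ k.+1)%N by rewrite expn_gt0 ltnW.
rewrite -(leq_exp2l m k.+1 q_gt1) nE -[X in (_ <= X)%N](prednK qk_gt0) ltnS.
apply: dvdn_leq; first by rewrite -ltnS prednK // -(exp1n k.+1) ltn_exp2r.
rewrite (prim_order_dvd x_prim); apply/eqP/(mulIf x0).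
by rewrite -exprSr prednK // mul1r -iterE.
Qed.

(** * Squares and nonsquares in the multiplicative group *)

Section QuadraticCharacter.
Variable F : finFieldType.
Hypothesis q_odd : odd #|F|.
Local Notation h := (#|F|./2).

Lemma card_odd_half : #|F| = (h.*2).+1.
Proof. by rewrite -[LHS]odd_double_half q_odd. Qed.

Lemma half_card_gt0 : (0 < h)%N.
Proof. by have := finNzRing_gt1 F; rewrite {1}card_odd_half ltnS double_gt0. Qed.

Lemma finField_prim_root : exists g : F, h.*2.-primitive_root g.
Proof.
pose rs := enum [set~ (0 : F)].
have rs_size : size rs = h.*2 by rewrite -cardE cardsC1 {1}card_odd_half.
have h2_gt0 : (0 < h.*2)%N by rewrite double_gt0 half_card_gt0.
have rs_roots : all (h.*2).-unity_root rs.
  apply/allP => a; rewrite mem_enum in_setC1 => a0; rewrite unity_rootE.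
  by apply/eqP/(mulIf a0); rewrite -exprSr -card_odd_half expf_card mul1r.
have := cyclic.has_prim_root h2_gt0 rs_roots (enum_uniq _) (eq_leq (esym rs_size)).
by case/hasP => g _ g_prim; exists g.
Qed.

(** For a generator [g] and [u = g ^+ i], the hypothesis on [u] makes [i] even, and Bezout gives [b]
    with [b * M] congruent to 2 modulo [#|F| - 1]; so [t = g ^+ (b * i./2)] works. *)
Lemma half_card_power (u : F) M : gcdn (#|F| - 1) M = 2 -> u ^+ h = 1 ->
  exists2 t : F, t != 0 & u = t ^+ M.
Proof.
have [g g_prim] := finField_prim_root; have h0 := half_card_gt0.
rewrite {1}card_odd_half subn1 /= => gcd2 uh1.
have g0 : g != 0 by rewrite (prim_root_eq0 g_prim) -lt0n double_gt0.
have [[i _] /= uE] : {i : 'I_(h.*2) | u = g ^+ i}.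
  by apply: (prim_rootP g_prim); rewrite -muln2 exprM uh1 expr1n.
have i_even : ~~ odd i.
  move/eqP: uh1; rewrite uE -exprM -(prim_order_dvd g_prim) -mul2n dvdn_pmul2r //.
  by rewrite dvdn2.
have h2_gt0 : (0 < h.*2)%N by rewrite double_gt0.
(* [M = 0] forces [#|F| - 1 = 2], hence [h = 1] and [u = 1]. *)
have [M0|M0] := posnP M.
  exists 1; rewrite ?oner_eq0 // M0 expr0.
  by move: gcd2 uh1; rewrite M0 gcdn0; case: (h) => [|[|k]].
have [b a abE _] := egcdnP h.*2 M0; exists (g ^+ (b * i./2));
  first by rewrite expf_neq0.
rewrite gcdnC gcd2 in abE.
rewrite -exprM mulnAC abE mulnDl exprD mulnAC [(_ * h.*2)%N]mulnC exprM
  (prim_expr_order g_prim).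
by rewrite expr1n mul1r mul2n even_halfK.
Qed.

(** By Euler's criterion, [false] gives the nonzero squares and [true] the nonsquares; the boolean
    is the exponent of the sign. *)
Definition euler_class (b : bool) : {set F} := [set a | a ^+ h == (-1) ^+ b].

Lemma euler_class_neq0 b : 0 \notin euler_class b.
Proof.
rewrite inE expr0n gtn_eqF ?half_card_gt0 //= eq_sym signr_eq0 //.
Qed.

Lemma euler_classP a : (a != 0) = (a \in euler_class false) || (a \in euler_class
  true).
Proof.
apply/idP/idP => [a0|]; first by rewrite !inE expr0 expr1 half_card_sign.
by apply: contraTneq => ->; rewrite !(negPf (euler_class_neq0 _)).
Qed.

Lemma chi_euler_class b a : a \in euler_class b -> chi a = (-1) ^+ b.
Proof.
move=> ab; have a0 : a != 0 by apply: contraTneq ab => ->; apply: euler_class_neq0.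
move: ab; rewrite inE /chi (negPf a0) => /eqP ->.
by case: b; rewrite ?expr0 ?expr1 ?eqxx // (negPf (odd_card_neqN1 q_odd)).
Qed.

Lemma euler_class_disjoint : [disjoint euler_class false & euler_class true].
Proof.
apply/pred0P => a /=; rewrite !inE expr0 expr1; apply/negP => /andP[/eqP ->].
by rewrite eq_sym (negPf (odd_card_neqN1 q_odd)).
Qed.

(** Multiplication by a generator [g] exchanges the two classes, since [g ^+ h = -1], and together
    they make up the nonzero elements. *)
Lemma card_euler_class b : #|euler_class b| = h.
Proof.
have [g g_prim] := finField_prim_root; have h0 := half_card_gt0.
have g0 : g != 0 by rewrite (prim_root_eq0 g_prim) -lt0n double_gt0.
have gN : g ^+ h = -1.
  apply/eqP; have := half_card_sign q_odd g0; rewrite -(prim_order_dvd g_prim).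
  by rewrite gtnNdvd // -addnn -[X in (X < _)%N]addn0 ltn_add2l.
have mulg c : (#|euler_class c| <= #|euler_class (~~ c)|)%N.
  rewrite -(card_imset _ (mulfI g0)); apply/subset_leq_card/subsetP =>
    _ /imsetP[a + ->].
  by rewrite !inE exprMn gN => /eqP ->; case: (c);
    rewrite ?expr1 ?expr0 ?mulrNN ?mulr1.
have cardE : #|euler_class b| = #|euler_class (~~ b)|.
  by apply/eqP; rewrite eqn_leq mulg /=; have := mulg (~~ b); rewrite negbK.
apply: double_inj; rewrite -addnn {2}cardE.
have -> : (#|euler_class b| + #|euler_class (~~ b)| = #|euler_class false| +
  #|euler_class true|)%N.
  by case: (b); rewrite // addnC.
rewrite -cardsUI (disjoint_setI0 euler_class_disjoint) cards0 addn0.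
rewrite (_ : _ :|: _ = [set~ 0]); first by rewrite cardsC1 {1}card_odd_half.
by apply/setP => a; rewrite in_setC1 euler_classP in_setU.
Qed.

End QuadraticCharacter.

(** * Equidistribution of discriminants *)

(** Passes from the finite sets of the theorem to counts in the list [monics]. *)
Lemma card_npoly_monic (F : finFieldType) m (C : pred {poly F}) :
  #|[set p : {poly_m.+1 F} | [&& (val p : {poly F}) \is monic, size (val p) ==
    m.+1 & C (val p)]]|
    = count C (monics F m).
Proof.
rewrite cardE -(size_map val) -size_filter; apply/perm_size/uniq_perm.
- by rewrite map_inj_uniq ?enum_uniq //; apply: val_inj.
- by rewrite filter_uniq ?monics_uniq.
move=> f; rewrite mem_filter mem_monics; apply/mapP/and3P => [[p]|[Cf f_monic szf]].
  by rewrite mem_enum inE => /and3P[? ? ?] ->.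
have szf' : (size f <= m.+1)%N by rewrite (eqP szf).
by exists (NPoly szf'); rewrite // mem_enum inE /= f_monic szf.
Qed.

Section Equidistribution.
Variables (F : finFieldType) (m : nat).
Hypothesis q_odd : odd #|F|.
Hypothesis gcd_m : gcdn (#|F| - 1) (m * (m - 1)) = 2.
Local Notation h := (#|F|./2).

Lemma count_disc_euler_class (C : pred {poly F}) b :
    (forall t, t != 0 -> {in monics F m, forall f, C f -> C (scale_roots t f)}) ->
  {in euler_class F b &, forall a a',
     count (fun f => C f && (disc f == a)) (monics F m)
       = count (fun f => C f && (disc f == a')) (monics F m)}.
Proof.
move=> C_scale.
suff le a a' : a \in euler_class F b -> a' \in euler_class F b ->
    (count (fun f => C f && (disc f == a)) (monics F m)
      <= count (fun f => C f && (disc f == a')) (monics F m))%N.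
  by move=> a a' ab ab'; apply/eqP; rewrite eqn_leq !le.
move=> ab ab'; have a0 : a != 0 by apply: contraTneq ab => ->;
  apply: euler_class_neq0.
have [|t t0 tE] := half_card_power q_odd (u := a' / a) gcd_m.
  move: ab ab'; rewrite !inE exprMn exprVn => /eqP -> /eqP ->.
  by rewrite divff // signr_eq0.
by rewrite -[a'](divfK a0) tE; apply: leq_count_scale_roots => //; apply: C_scale.
Qed.

Lemma sum_monics_disc (G : F -> int) (N := fun a => count (fun f =>
  disc f == a) (monics F m)) :
  \sum_(f <- monics F m) G (disc f) = G 0 * (N 0)%:R +
    (\sum_(a in euler_class F false) G a * (N a)%:R + \sum_(a in euler_class F
      true) G a * (N a)%:R).
Proof.
transitivity (\sum_a G a * (N a)%:R).
  transitivity (\sum_(f <- monics F m) \sum_(a | disc f == a) G a).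
    by apply: eq_bigr => f _; rewrite (big_pred1 (disc f)).
  under eq_bigr do rewrite big_mkcond.
  rewrite exchange_big; apply: eq_bigr => a _.
  rewrite -big_mkcond /= /N -sum1_count natr_sum mulr_sumr.
  by apply: eq_bigr => f _; rewrite mulr1.
rewrite (bigD1 0) //=; congr (_ + _); rewrite -bigU ?euler_class_disjoint //.
by apply: eq_bigl => a; rewrite euler_classP // in_setU.
Qed.

(** There are three unknowns, the counts at 0, at each nonzero square and at each nonsquare. The
    vanishing sum of [chi] equates the last two, the number of nonzero discriminants gives their
    common value, and the total [#|F| ^ m] gives the count at 0. *)
Lemma count_disc a : (1 < m)%N ->
  count (fun f => disc f == a) (monics F m) = (#|F| ^ (m - 1))%N.
Proof.
move=> m_gt1; pose N a := count (fun f : {poly F} => disc f == a) (monics F m).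
have [c Nc] : exists c : bool -> nat, forall b x, x \in euler_class F b -> N x =
  c b.
  have pickS b : exists x, x \in euler_class F b.
    by apply/card_gt0P; rewrite card_euler_class // half_card_gt0.
  exists (fun b => N (xchoose (pickS b))) => b x xb.
  exact: (count_disc_euler_class (C := xpredT)) xb (xchooseP (pickS b)).
have sumS G b (v : int) : {in euler_class F b, forall x, G x = v} ->
    \sum_(x in euler_class F b) G x * (N x)%:R = v * (h * c b)%N%:R.
  move=> Gv; rewrite (eq_bigr (fun=> v * (c b)%:R)).
    by rewrite sumr_const card_euler_class // -mulrnAr -mulrnA mulnC.
  by move=> x xb; rewrite Gv // (Nc b).
have chi_sum : \sum_(f <- monics F m) chi (disc f) = 0.
  have := sum_mu_eq0 q_odd m_gt1; rewrite /sum_mu.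
  rewrite (eq_big_seq (fun f => (-1) ^+ m * chi (disc f))).
    by rewrite -mulr_sumr => /eqP; rewrite mulf_eq0 signr_eq0 => /eqP.
  by move=> f; rewrite mem_monics /mu => /andP[_ /eqP->].
have c01 : c false = c true.
  move: chi_sum; rewrite sum_monics_disc {1}/chi eqxx mul0r add0r.
  rewrite (sumS _ _ 1) ?(sumS _ _ (-1)); last 2 first.
  - by move=> x /chi_euler_class ->.
  - by move=> x /chi_euler_class ->.
  rewrite mul1r mulN1r => /eqP;
    rewrite subr_eq0 Num.Theory.eqr_nat eqn_pmul2l ?half_card_gt0 //.
  by move/eqP.
have q_pow : (#|F| ^ m = #|F| ^ (m - 1) + h.*2 * #|F| ^ (m - 1))%N.
  by rewrite -mulSn -card_odd_half // -expnS subn1 prednK // ltnW.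
have c_val b : c b = (#|F| ^ (m - 1))%N.
  have -> : c b = c false by case: b.
  have := sum_disc_neq0 q_odd m_gt1; rewrite -subn1 q_pow natrD addrC addKr.
  rewrite (sum_monics_disc (fun x => (x != 0)%:R)) eqxx mul0r add0r.
  have S1 b' : {in euler_class F b', forall x : F, (x != 0%R)%:R = 1 :> int}.
    by move=> x; case: eqP => // ->; rewrite (negPf (euler_class_neq0 _ _)).
  rewrite !(sumS _ _ 1) // !mul1r -c01 -natrD addnn doubleMl => /eqP.
  by rewrite Num.Theory.eqr_nat eqn_pmul2l ?double_gt0 ?half_card_gt0 // => /eqP.
have [->|a0] := eqVneq a 0; last first.
  by move: a0; rewrite (euler_classP q_odd) => /orP[] /Nc; rewrite c_val.
have : \sum_(f <- monics F m) 1 = (#|F| ^ m)%N%:R :> int.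
  by rewrite -size_monics -sum1_size natr_sum.
rewrite (sum_monics_disc (fun=> 1)) !(sumS _ _ 1) // !c_val !mul1r -!natrD => /eqP.
by rewrite Num.Theory.eqr_nat q_pow addnn doubleMl eqn_add2r => /eqP.
Qed.
End Equidistribution.

Theorem theorem1p1 (F : finFieldType) (m : nat) :
  odd #|F| -> (2 <= m)%N -> gcdn (#|F| - 1) (m * (m - 1)) = 2%N ->
  (* (i) *)
  (forall d : F,
     #|[set p : {poly_m.+1 F} | [&& (val p : {poly F}) \is monic,
          size (val p) == m.+1 & disc (val p) == d]]| = (#|F| ^ (m - 1))%N)
  /\
  (* (ii) *)
  (exists A : {set F},
     [/\ 0 \notin A,
         #|A| = ((#|F| - 1) %/ 2)%N,
         (forall p : {poly F}, p \is monic -> size p = m.+1 ->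
            irreducible_poly p -> disc p \in A)
       & exists2 N : nat, (0 < N)%N &
         forall a, a \in A ->
           #|[set p : {poly_m.+1 F} | [&& (val p : {poly F}) \is monic,
                size (val p) == m.+1, irreducibleb (val p)
              & disc (val p) == a]]| = N]).
Proof.
move=> q_odd m_gt1 gcd_m; split=> [d|].
  by rewrite (card_npoly_monic m (fun f => disc f == d)) count_disc.
(* The sign is [(-1) ^+ size p] with [size p = m.+1], which has the parity of [m - 1]. *)
pose A := euler_class F (odd m.+1).
have disc_irr (p : {poly F}) : p \is monic -> size p = m.+1 -> irreducible_poly p
  -> disc p \in A.
  move=> p_monic szp p_irr; rewrite inE signr_odd -szp.
  by apply/eqP; case: (disc_irreducible q_odd p_monic p_irr).
have [P [P_monic szP P_irr]] := monic_irreducible_exists F (ltnW m_gt1).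
pose N a := count (fun f : {poly F} =>
  irreducibleb f && (disc f == a)) (monics F m).
exists A; split=> //.
- exact: euler_class_neq0.
- by rewrite card_euler_class // {2}card_odd_half // subn1 /= divn2 doubleK.
(* The common count is read off at the discriminant of a known irreducible [P], which makes it
   positive. *)
exists (N (disc P)).
  rewrite -has_count; apply/hasP; exists P; rewrite ?mem_monics ?P_monic ?szP //=.
  by rewrite eqxx andbT; apply/irreducibleP.
move=> a aA; rewrite (card_npoly_monic m (fun f =>
  irreducibleb f && (disc f == a))).
apply: (count_disc_euler_class q_odd gcd_m (C := fun f =>
  irreducibleb f)) aA (disc_irr P P_monic szP P_irr).
move=> t t0 f _ /irreducibleP f_irr; apply/irreducibleP;
  exact: irreducible_scale_roots.
Qed.
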